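(* There is an absolute constant $C$ such that for every finite field $\mathbb{F}_q$ and degree $d$ with $q>C\cdot d$, and every $\delta<0.01$, the following holds: if $f:\mathbb{F}_q^2\to\mathbb{F}_q$ passes $\mathrm{LDT}_d$ with probability at least $1-\delta$, then there is a bivariate polynomial $Q$ of total degree at most $d$ such that $\Pr_{\mathbf{x}\in\mathbb{F}_q^2}[f(\mathbf{x})=Q(\mathbf{x})]\ge 1-2\delta$.
   Context: An (affine) line in $\mathbb{F}^m$ is a set $\ell=\{\mathbf{a}+t\mathbf{u}:t\in\mathbb{F}\}$ with $\mathbf{u}\neq 0$; a degree-$d$ polynomial on $\ell$ is a function on $\ell$ given, under a parametrization, by a univariate polynomial of degree at most $d$ in $t$. For $f:\mathbb{F}^m\to\mathbb{F}$ and a line $\ell$, $P^{(f,d)}_\ell$ denotes a degree-$d$ polynomial on $\ell$ agreeing with $f|_\ell$ on the maximum number of points of $\ell$ (ties broken arbitrarily). The test $\mathrm{LDT}_d$ picks a uniform point $\mathbf{a}$ and a uniform line $\ell\ni\mathbf{a}$ and accepts iff $P^{(f,d)}_\ell(\mathbf{a})=f(\mathbf{a})$. *)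

(* Defs.v *)
From HB Require Import structures.
From mathcomp Require Import all_boot all_order all_algebra.
From mathcomp Require Import mpoly.
Set Implicit Arguments. Unset Strict Implicit. Unset Printing Implicit Defensive.
Import Order.TTheory GRing.Theory Num.Theory.
Local Open Scope ring_scope.

Definition line_of (F : finFieldType) (m : nat) (a u : 'rV[F]_m) : {set 'rV[F]_m} :=
  [set a + t *: u | t : F].

Definition is_line (F : finFieldType) (m : nat) (L : {set 'rV[F]_m}) : Prop :=
  exists a u : 'rV[F]_m, u != 0 /\ L = line_of a u.

Definition deg_poly_on_line (F : finFieldType) (m d : nat)
    (L : {set 'rV[F]_m}) (g : 'rV[F]_m -> F) : Prop :=
  exists (a u : 'rV[F]_m) (p : {poly F}),
    [/\ u != 0, L = line_of a u, (size p <= d.+1)%N &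
        forall t : F, g (a + t *: u) = p.[t]].

Definition agree_on (F : finFieldType) (m : nat) (L : {set 'rV[F]_m})
    (f g : 'rV[F]_m -> F) : nat :=
  #|[set x in L | g x == f x]|.

(* P is a valid choice of the decoded polynomials P^{(f,d)}_L: for every
   line L, P L is a degree-d polynomial on L agreeing with f|_L on the
   maximum number of points of L (ties broken arbitrarily, i.e. any such
   choice function is allowed). *)
Definition best_line_decoder (F : finFieldType) (m d : nat)
    (f : 'rV[F]_m -> F) (P : {set 'rV[F]_m} -> 'rV[F]_m -> F) : Prop :=
  forall L, is_line L ->
    deg_poly_on_line d L (P L) /\
    forall g, deg_poly_on_line d L g -> (agree_on L f g <= agree_on L f (P L))%N.

Definition lines_through (F : finFieldType) (m : nat) (a : 'rV[F]_m)
    : {set {set 'rV[F]_m}} :=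
  [set L : {set 'rV[F]_m} | [exists u : 'rV[F]_m, (u != 0) && (L == line_of a u)]].

Definition ldt_accept_prob (R : realFieldType) (F : finFieldType) (m : nat)
    (f : 'rV[F]_m -> F) (P : {set 'rV[F]_m} -> 'rV[F]_m -> F) : R :=
  (#|'rV[F]_m|%:R)^-1 *
  \sum_(a : 'rV[F]_m)
     (#|[set L in lines_through a | P L a == f a]|%:R /
      #|lines_through a|%:R).

Definition eval2 (F : finFieldType) (Q : {mpoly F[2]}) (x : 'rV[F]_2) : F :=
  Q.@[fun i : 'I_2 => x ord0 i].

Definition agree_prob2 (R : realFieldType) (F : finFieldType)
    (f : 'rV[F]_2 -> F) (Q : {mpoly F[2]}) : R :=
  #|[set x : 'rV[F]_2 | f x == eval2 Q x]|%:R / #|'rV[F]_2|%:R.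

(* Main.v *)
(* Let [N] count the pairs (point [a], direction [w <> 0]) at which the test
   rejects, and [q = #|F|].

   For [d = 0], decoded polynomials are constant on lines, so [f a <> f (a + w)]
   forces a rejection at [a] or at [a + w] in direction [w]; the most frequent
   value of [f] is the required constant.

   For [d > 0], two independent directions reject rarely, which gives row and
   column polynomials agreeing on most of a [q x q] grid. Following Polishchuk
   and Spielman, take a nonzero [E] of bidegree about [3q/20] vanishing at the
   disagreements, and interpolate [P = row * E = col * E]. Common factors of [E]
   and [P] are divided out, each at the price of as many rows and columns as its
   degree. Were the coprime [E] not constant, the resultant of [E] and [P] would
   vanish to order [deg E] at every good row, more than its degree allows. Hence
   the rows are mostly the restrictions of one [Q] of bidegree [(d, d)]. The
   homogeneous part of [Q] of top degree [e > d] would make almost every direction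
   reject almost everywhere, so [Q] has total degree at most [d]. Finally, at an
   error point of [f], a line can be accepted only if half of its points are
   errors, so at least half of the lines through it reject: this gives the
   factor 2. *)
Require Import Defs.
From HB Require Import structures.
From mathcomp Require Import all_boot all_order all_algebra.
From mathcomp Require Import perm polyXY zify ring.
From mathcomp Require Import mpoly.
Import Order.TTheory GRing.Theory Num.Theory.
Set Implicit Arguments.
Unset Strict Implicit.
Unset Printing Implicit Defensive.
Local Open Scope ring_scope.

(* The same [size p] or [#|A|] may occur with different inferred structures,
   which [lia] would treat as distinct atoms. *)
Ltac size_lia :=
  repeat match goal with
  | H : is_true (leq _ _) |- _ => revert H
  | H : @eq nat _ _ |- _ => revert H
  | H : @eq bool (leq _ _) _ |- _ => revert H
  end;
  repeat match goal with
  | |- context [size ?p] => let n := fresh "n" in set n := (size p); clearbody n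
  | |- context [sizeY ?p] => let n := fresh "n" in set n := (sizeY p); clearbody n
  | |- context [@card ?T ?A] =>
      let n := fresh "n" in set n := (@card T A); clearbody n
  end;
  intros; lia.

(** * Roots, multiplicities and degree of a resultant *)

Lemma size_det_leq (R : comNzRingType) (n : nat) (M : 'M[{poly R}]_n)
    (b : 'I_n -> nat) :
  (forall i j, size (M i j) <= (b i).+1)%N ->
  (size (\det M) <= (\sum_i b i).+1)%N.
Proof.
move=> leM; apply: leq_trans (size_sum _ _ _) _; apply/bigmax_leqP => s _.
rewrite -polyCN -polyC1 -polyC_exp mul_polyC.
apply: leq_trans (size_scale_leq _ _) _.
elim/big_rec2: _ => [|i k p _ IH]; first by rewrite size_poly1.
apply: leq_trans (size_polyMleq _ _) _.
have := leM i (s i); move: IH. size_lia.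
Qed.

(** At [y] the rows of [B] are combinations of those of [A]. Subtracting these combinations keeps
    the determinant and makes every entry of the last [n] rows divisible by ['X - y%:P], so each of
    these rows yields one factor. *)
Lemma dvd_det_col_mx (F : fieldType) (y : F) (m n : nat)
    (A : 'M[{poly F}]_(m, m + n)) (B : 'M[{poly F}]_(n, m + n))
    (T : 'M[F]_(n, m)) :
  map_mx (horner_eval y) B = T *m map_mx (horner_eval y) A ->
  ('X - y%:P) ^+ n %| \det (col_mx A B).
Proof.
move=> eqBA; set TP := map_mx polyC T.
have rootBA i j : root ((B - TP *m A) i j) y.
  have /matrixP/(_ i j) := eqBA; rewrite !mxE /horner_eval => eqBy.
  rewrite /root hornerD hornerN eqBy horner_sum subr_eq0; apply/eqP.
  by apply: eq_bigr => k _; rewrite !mxE hornerM hornerC.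
pose D : 'M[{poly F}]_(n, m + n) :=
  \matrix_(i, j) ((B - TP *m A) i j %/ ('X - y%:P)).
have DE : B - TP *m A = ('X - y%:P) *: D.
  apply/matrixP => i j; have := rootBA i j; rewrite -dvdp_XsubCl => /divpK {1}<-.
  by rewrite [RHS]mxE [D i j]mxE mulrC.
have -> : \det (col_mx A B) = \det (col_mx A (('X - y%:P) *: D)).
  rewrite -DE -[LHS]mul1r.
  have <- : \det (block_mx (1%:M : 'M[{poly F}]_m) 0 (- TP) (1%:M : 'M_n)) = 1.
    by rewrite det_lblock !det1 mulr1.
  by rewrite -det_mulmx mul_block_col !mul1mx mul0mx addr0 mulNmx addrC.
have -> : col_mx A (('X - y%:P) *: D) =
    block_mx 1%:M 0 0 ('X - y%:P)%:M *m col_mx A D.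
  by rewrite mul_block_col !mul1mx !mul0mx addr0 add0r mul_scalar_mx.
by rewrite det_mulmx det_lblock det1 mul1r det_scalar dvdp_mulr.
Qed.

(** These matrices represent multiplication by [p] on coefficient vectors; they are the blocks of a
    Sylvester matrix. *)
Lemma map_band (R : comNzRingType) (y : R) (m n : nat) (p : {poly {poly R}}) :
  map_mx (horner_eval y) (lin1_mx (poly_rV \o p \o* rVpoly) : 'M_(m, n)) =
  lin1_mx (poly_rV \o map_poly (horner_eval y) p \o* rVpoly) :> 'M[R]_(m, n).
Proof.
apply/matrixP => i j; rewrite !mxE /= !rVpoly_delta !coefXnM.
by case: ifP => _; rewrite ?coef_map // /horner_eval horner0.
Qed.

Lemma band_mul (R : comNzRingType) (e m n : nat) (c p : {poly R}) :
  (size c + e <= m.+1)%N ->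
  (lin1_mx (poly_rV \o (c * p) \o* rVpoly) : 'M[R]_(e, n)) =
  (lin1_mx (poly_rV \o c \o* rVpoly) : 'M_(e, m)) *m
    lin1_mx (poly_rV \o p \o* rVpoly).
Proof.
move=> szc; apply/row_matrixP => i; rewrite row_mul !rowE !mul_rV_lin1 /=.
rewrite poly_rV_K ?mulrA // rVpoly_delta.
apply: leq_trans (size_polyMleq _ _) _; rewrite size_polyXn.
have := ltn_ord i; size_lia.
Qed.

(** At [y], the [(size E).-1] rows of the Sylvester matrix that come from [P] depend on those that
    come from [E]. Since the leading coefficient of [E] survives at [y], degrees force [c] to be
    short enough for its shifts to fit in the block of [E]. *)
Lemma dvd_resultant (F : fieldType) (E P : {poly {poly F}}) (y : F)
    (c : {poly F}) :
  (lead_coef E).[y] != 0 -> (1 < size E)%N ->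
  map_poly (horner_eval y) P = c * map_poly (horner_eval y) E ->
  ('X - y%:P) ^+ (size E).-1 %| resultant E P.
Proof.
move=> lcy szE eqP; rewrite /resultant /Sylvester_mx.
have szEy : size (map_poly (horner_eval y) E) = size E.
  by rewrite size_map_poly_id0.
have Ey0 : map_poly (horner_eval y) E != 0 by rewrite -size_poly_gt0 szEy; size_lia.
apply: (@dvd_det_col_mx _ _ _ _ _ _
  (lin1_mx (poly_rV \o c \o* rVpoly))).
rewrite !map_band eqP; have [->|c0] := eqVneq c 0.
  rewrite mul0r; apply/matrixP => i j; rewrite !mxE /= mulr0 coef0.
  by rewrite big1 // => k _; rewrite !mxE /= mulr0 coef0 mul0r.
apply: band_mul.
have : (size (map_poly (horner_eval y) P) <= size P)%N by exact: size_poly.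
rewrite eqP size_mul // szEy; have : (0 < size c)%N by rewrite size_poly_gt0.
by size_lia.
Qed.

Lemma dvd_prod_XsubC_exp (F : fieldType) (s : seq F) (e : nat) (p : {poly F}) :
  uniq s -> (forall x, x \in s -> ('X - x%:P) ^+ e %| p) ->
  (\prod_(x <- s) ('X - x%:P)) ^+ e %| p.
Proof.
elim: s => [|x s IH] /=; first by rewrite big_nil expr1n dvd1p.
case/andP=> xs us sp; rewrite big_cons exprMn Gauss_dvdp.
  rewrite sp ?mem_head // IH // => z zs.
  by rewrite sp // inE zs orbT.
apply: coprimep_expl; apply: coprimep_expr.
by rewrite coprimep_sym coprimep_XsubC root_prod_XsubC.
Qed.

(** The Sylvester matrix has [(size P).-1] rows of degree at most [e] and [(size E).-1] rows of
    degree at most [p]. *)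
Lemma size_resultant_leq (F : fieldType) (E P : {poly {poly F}}) (e p : nat) :
  (sizeY E <= e.+1)%N -> (sizeY P <= p.+1)%N ->
  (size (resultant E P) <= ((size P).-1 * e + (size E).-1 * p).+1)%N.
Proof.
move=> leE leP.
pose b (i : 'I_((size P).-1 + (size E).-1)) :=
  match split i with inl _ => e | inr _ => p end.
apply: leq_trans (@size_det_leq _ _ _ b _) _ => [i j|].
  rewrite Sylvester_mxE /b; case: (split i) => k.
    case: (k <= j)%N; rewrite ?mulr0n ?size_poly0 //.
    exact: leq_trans (max_size_coefXY _ _) leE.
  case: (k <= j)%N; rewrite ?mulr0n ?size_poly0 //.
  exact: leq_trans (max_size_coefXY _ _) leP.
rewrite big_split_ord /= ltnS leq_add // /b.
  rewrite (eq_bigr (fun=> e)) => [|i _]; first by rewrite sum_nat_const card_ord.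
  by rewrite (unsplitK (inl i)).
rewrite (eq_bigr (fun=> p)) => [|i _]; first by rewrite sum_nat_const card_ord.
by rewrite (unsplitK (inr i)).
Qed.

Lemma resultant_root_bound (F : fieldType) (E P : {poly {poly F}})
    (s : seq F) (e p : nat) :
  (1 < size E)%N -> (sizeY E <= e.+1)%N -> (sizeY P <= p.+1)%N -> uniq s ->
  (forall y, y \in s -> (lead_coef E).[y] != 0 /\
     exists c, map_poly (horner_eval y) P = c * map_poly (horner_eval y) E) ->
  resultant E P != 0 ->
  ((size E).-1 * size s <= (size P).-1 * e + (size E).-1 * p)%N.
Proof.
move=> szE leE leP us sP res0.
have : (\prod_(y <- s) ('X - y%:P)) ^+ (size E).-1 %| resultant E P.
  apply: dvd_prod_XsubC_exp => // y /sP[lcy [c eqc]].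
  exact: dvd_resultant eqc.
move/(dvdp_leq res0)/leq_trans/(_ (size_resultant_leq leE leP)).
have -> : size ((\prod_(y <- s) ('X - y%:P)) ^+ (size E).-1) =
    (size s * (size E).-1).+1.
  rewrite -[LHS]prednK ?size_exp ?size_prod_XsubC // size_poly_gt0.
  by rewrite expf_neq0 // monic_neq0 // monic_prod_XsubC.
by rewrite ltnS mulnC.
Qed.

(** * Gauss's lemma and common factors over [F[y]] *)

Lemma irreducible_factor (F : finFieldType) (c : {poly F}) : (1 < size c)%N ->
  exists2 p, irreducible_poly p & p %| c.
Proof.
have [n] := ubnP (size c); elim: n c => // n IH c; rewrite ltnS => lec szc.
(* Candidate divisors are coded by coefficient vectors, a finite type, so that having a proper
   divisor is decidable. *)
pose T := 'rV[F]_(size c).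
case: (boolP [exists v : T, [&& size (rVpoly v) != 1, rVpoly v %| c &
    ~~ (rVpoly v %= c)]]) => [/existsP[v /and3P[v1 vc nvc]]|/existsPn irr].
  have c0 : c != 0 by rewrite -size_poly_gt0; size_lia.
  have v0 : rVpoly v != 0 by apply: contraTneq vc => ->; rewrite dvd0p.
  have lt_vc : (size (rVpoly v) < size c)%N.
    rewrite ltn_neqAle (dvdp_leq c0 vc) andbT.
    by apply: contra nvc => /eqP e; rewrite -dvdp_size_eqp // e.
  have := v0; rewrite -size_poly_gt0 => v_gt0.
  have [||p irrp pv] := IH (rVpoly v); [size_lia|move: v1; size_lia|].
  by exists p => //; apply: dvdp_trans vc.
exists c; last exact: dvdpp.
split=> // v v1 vc; apply/negPn/negP => nvc.
have c0 : c != 0 by rewrite -size_poly_gt0; size_lia.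
have := irr (poly_rV v); rewrite poly_rV_K ?dvdp_leq //.
by rewrite v1 vc nvc.
Qed.

Lemma scale_dvdp_coef (F : fieldType) (p : {poly F}) (G : {poly {poly F}}) :
  (forall i, p %| G`_i) -> exists G', G = p *: G'.
Proof.
move=> pG; exists (\poly_(i < size G) (G`_i %/ p)).
apply/polyP => i; rewrite coefZ coef_poly; case: ltnP => [_|le].
  by rewrite mulrC divpK.
by rewrite mulr0 nth_default.
Qed.

(** If [p] misses some coefficient of [G], take the first such index [i]. In the coefficient of
    index [i + j] of [G * H], every term other than [G_i * H_j] contains an earlier coefficient of
    [G] or of [H], so [p] divides [H_j] by induction on [j]. *)
Lemma irreducible_dvd_content (F : fieldType) (p : {poly F})
    (G H K : {poly {poly F}}) :
  irreducible_poly p -> p *: K = G * H ->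
  (exists G', G = p *: G') \/ (exists H', H = p *: H').
Proof.
move=> irrp eqK.
have pGH k : p %| (G * H)`_k by rewrite -eqK coefZ dvdp_mulr.
case: (boolP [forall i : 'I_(size G), p %| G`_i]) => [/forallP pG|].
  left; apply: scale_dvdp_coef => i; have [lt|le] := ltnP i (size G).
    exact: (pG (Ordinal lt)).
  by rewrite nth_default.
case/forallPn => i0 npi0.
have exG : exists i, ~~ (p %| G`_i) by exists i0.
right; apply: scale_dvdp_coef.
case: (ex_minnP exG) => i npi mini; elim/ltn_ind => j IHj.
have := pGH (i + j)%N; rewrite coefM.
have lti : (i < (i + j).+1)%N by size_lia.
rewrite (bigD1 (Ordinal lti)) //= addKn.
rewrite addrC dvdp_addr => [|].
  by rewrite Gauss_dvdpr // irreducible_poly_coprime.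
apply: (big_ind (fun x => p %| x)) => [||k nk]; rewrite ?dvdp0 //.
  exact: dvdp_add.
have [ltk|gek] := ltnP k i.
  by rewrite dvdp_mulr //; apply: contraTT ltk => /mini; rewrite -leqNgt.
have nki : (k != i :> nat) by apply: contra nk => /eqP e; apply/eqP/val_inj.
by rewrite dvdp_mull // IHj //; have := ltn_ord k; size_lia.
Qed.

(** The irreducible factors of [c] are cancelled one at a time: each divides [G], or else both [H]
    and [K]. *)
Lemma gauss_common_factor (F : finFieldType) (c : {poly F})
    (E P G H K : {poly {poly F}}) :
  c != 0 -> (1 < size G)%N -> c *: E = G * H -> c *: P = G * K ->
  exists G' H' K' : {poly {poly F}}, [/\ (1 < size G')%N, E = G' * H' & P = G' * K'].
Proof.
have [n] := ubnP (size c); elim: n c G H K => // n IH c G H K.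
rewrite ltnS => szc c0 szG eqE eqPK; have [c1|c1] := leqP (size c) 1.
  have cE := size1_polyC c1; set k := c`_0 in cE.
  have k0 : k != 0 by apply: contraNneq c0 => k0; rewrite cE k0.
  exists G, (k^-1%:P *: H), (k^-1%:P *: K); split=> //.
    by rewrite -scalerAr -eqE cE scalerA -polyCM mulVf // scale1r.
  by rewrite -scalerAr -eqPK cE scalerA -polyCM mulVf // scale1r.
have [p irrp /dvdpP[c' eqc]] := irreducible_factor c1.
have p0 : p != 0 by case: irrp => sp _; rewrite -size_poly_gt0; size_lia.
have c'0 : c' != 0 by apply: contraNneq c0 => e; rewrite eqc e mul0r.
have lt_c' : (size c' < n)%N.
  move: szc; rewrite eqc size_mul //; case: irrp => sp _.
  move: c'0; rewrite -size_poly_gt0; size_lia.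
have injp : injective (fun u : {poly {poly F}} => p *: u).
  by move=> u v /=; rewrite -!mul_polyC; apply: mulfI; rewrite polyC_eq0.
have pE : p *: (c' *: E) = G * H by rewrite scalerA mulrC -eqc.
have pP : p *: (c' *: P) = G * K by rewrite scalerA mulrC -eqc.
have [[G' eqG]|[H' eqH]] := irreducible_dvd_content irrp pE.
  apply: (IH c' G' H K) => //.
  - by move: szG; rewrite eqG size_scale.
  - by apply: injp; rewrite pE eqG scalerAl.
  - by apply: injp; rewrite pP eqG scalerAl.
have [[G' eqG]|[K' eqK]] := irreducible_dvd_content irrp pP.
  apply: (IH c' G' H K) => //.
  - by move: szG; rewrite eqG size_scale.
  - by apply: injp; rewrite pE eqG scalerAl.
  - by apply: injp; rewrite pP eqG scalerAl.
apply: (IH c' G H' K') => //.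
- by apply: injp; rewrite pE eqH scalerAr.
- by apply: injp; rewrite pP eqK scalerAr.
Qed.

(** Pseudo-division by the gcd leaves scalars [c1] and [c2] in [F[y]], which Gauss's lemma then
    removes. *)
Lemma resultant0_common_factor (F : finFieldType) (E P : {poly {poly F}}) :
  resultant E P = 0 ->
  exists G H K : {poly {poly F}}, [/\ (1 < size G)%N, E = G * H & P = G * K].
Proof.
move/eqP; rewrite resultant_eq0 => szG.
have /Pdiv.Idomain.dvdpP[[c1 H] /= c10 eqE] := dvdp_gcdl E P.
have /Pdiv.Idomain.dvdpP[[c2 K] /= c20 eqP] := dvdp_gcdr E P.
apply: (@gauss_common_factor _ (c1 * c2) _ _ _ (c2 *: H) (c1 *: K)) szG _ _.
- by rewrite mulf_neq0.
- by rewrite mulrC -scalerA eqE scalerAl mulrC.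
- by rewrite -scalerA eqP scalerAl mulrC.
Qed.

(** * Dividing out common factors until a polynomial remains *)

Lemma card_roots_lt (F : finFieldType) (p : {poly F}) : p != 0 ->
  (#|[set x | root p x]| < size p)%N.
Proof.
move=> p0; rewrite cardE; apply: max_poly_roots => //; last exact: enum_uniq.
by apply/allP => x; rewrite mem_enum inE.
Qed.

Lemma card_hornerX_eq0_lt (F : finFieldType) (G : {poly {poly F}}) : G != 0 ->
  (#|[set x : F | G.[x%:P] == 0%R]| < size G)%N.
Proof.
move=> G0; rewrite cardE -(size_map polyC (enum _)).
apply: (@max_poly_roots {poly F} G) => //.
  by apply/allP => _ /mapP[x + ->]; rewrite mem_enum inE.
by rewrite map_inj_uniq ?enum_uniq //; apply: polyC_inj.
Qed.

Lemma card_hornerY_eq0_lt (F : finFieldType) (G : {poly {poly F}}) : G != 0 ->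
  (#|[set y | map_poly (horner_eval y) G == 0%R]| < sizeY G)%N.
Proof.
move=> G0; rewrite sizeYE.
under eq_finset => y do rewrite -horner_swapXY.
by apply: card_hornerX_eq0_lt; rewrite swapXY_eq0.
Qed.

Lemma sizeY_mul (F : fieldType) (G H : {poly {poly F}}) : G != 0 -> H != 0 ->
  sizeY (G * H) = (sizeY G + sizeY H).-1.
Proof.
by move=> G0 H0; rewrite !sizeYE rmorphM /= size_mul // swapXY_eq0.
Qed.

Lemma sizeY_gt0 (F : fieldType) (G : {poly {poly F}}) :
  (0 < sizeY G)%N = (G != 0).
Proof. by rewrite lt0n sizeY_eq0. Qed.

(* [P / E] restricts to the column polynomials on [Xs] and to the row
   polynomials on [Ys]; every exceptional row or column is paid for by the
   degree of [E]. *)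
Definition quotient_fit (F : finFieldType) (d a : nat) (col row : F -> {poly F})
    (E P : {poly {poly F}}) (Xs Ys : {set F}) : Prop :=
  [/\ E != 0,
      (size P <= size E + d)%N /\ (sizeY P <= sizeY E + d)%N,
      (#|~: Xs| + size E <= a.+1)%N /\ (#|~: Ys| + sizeY E <= a.+1)%N,
      forall x, x \in Xs -> P.[x%:P] = col x * E.[x%:P] &
      forall y, y \in Ys ->
        map_poly (horner_eval y) P = row y * map_poly (horner_eval y) E].

Definition polynomial_fit (F : finFieldType) (d a : nat)
    (col row : F -> {poly F}) (Q : {poly {poly F}}) : Prop :=
  [/\ (size Q <= d.+1)%N, (sizeY Q <= d.+1)%N,
      (#|[set x | Q.[x%:P] != col x]| <= a)%N &
      (#|[set y | map_poly (horner_eval y) Q != row y]| <= a)%N].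

Lemma quotient_fit_swap (F : finFieldType) (d a : nat) (col row : F -> {poly F})
    (E P : {poly {poly F}}) (Xs Ys : {set F}) :
  quotient_fit d a col row E P Xs Ys ->
  quotient_fit d a row col (swapXY E) (swapXY P) Ys Xs.
Proof.
case=> E0 [sP sYP] [cX cY] fx fy; split.
- by rewrite swapXY_eq0.
- by rewrite -!sizeYE !sizeYE !swapXYK -!sizeYE.
- by rewrite -!sizeYE !sizeYE !swapXYK -!sizeYE.
- by move=> y yY; rewrite !horner_swapXY; apply: fy.
- by move=> x xX; rewrite -!horner_polyC; apply: fx.
Qed.

Lemma polynomial_fit_swap (F : finFieldType) (d a : nat)
    (col row : F -> {poly F}) (Q : {poly {poly F}}) :
  polynomial_fit d a row col Q -> polynomial_fit d a col row (swapXY Q).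
Proof.
case=> sQ sYQ cY cX; split.
- by rewrite -sizeYE.
- by rewrite sizeYE swapXYK.
- by under eq_finset => x do rewrite horner_swapXY.
- by under eq_finset => y do rewrite -horner_polyC.
Qed.

(** [G] can be cancelled except on the rows and columns where it vanishes identically. There are at
    most as many of these as the degree of [G] in the relevant variable, which is what the
    denominator loses. *)
Lemma quotient_fit_div (F : finFieldType) (d a : nat) (col row : F -> {poly F})
    (G H K : {poly {poly F}}) (Xs Ys : {set F}) :
  quotient_fit d a col row (G * H) (G * K) Xs Ys ->
  exists Xs' Ys', quotient_fit d a col row H K Xs' Ys'.
Proof.
case; rewrite mulf_eq0 negb_or => /andP[G0 H0] [sP sYP] [cX cY] fx fy.
exists (Xs :\: [set x : F | G.[x%:P] == 0]),
  (Ys :\: [set y | map_poly (horner_eval y) G == 0]).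
have gG : (0 < size G)%N by rewrite size_poly_gt0.
have gYG : (0 < sizeY G)%N by rewrite sizeY_gt0.
split=> //.
- have [->|K0] := eqVneq K 0.
    have -> : sizeY (0 : {poly {poly F}}) = 0%N by apply/eqP; rewrite sizeY_eq0.
    by rewrite size_poly0.
  have gK : (0 < size K)%N by rewrite size_poly_gt0.
  have gYK : (0 < sizeY K)%N by rewrite sizeY_gt0.
  have gH : (0 < size H)%N by rewrite size_poly_gt0.
  have gYH : (0 < sizeY H)%N by rewrite sizeY_gt0.
  by move: sP sYP; rewrite !sizeY_mul // !size_mul //; split; size_lia.
- move: cX cY; rewrite sizeY_mul // size_mul // !setCD => cX cY.
  have := card_hornerX_eq0_lt G0; have := card_hornerY_eq0_lt G0.
  have := leq_card_setU (~: Xs) [set x : F | G.[x%:P] == 0].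
  have := leq_card_setU (~: Ys) [set y | map_poly (horner_eval y) G == 0].
  have : (0 < sizeY H)%N by rewrite sizeY_gt0.
  have : (0 < size H)%N by rewrite size_poly_gt0.
  move=> ? ? /leq_of_leqif ? /leq_of_leqif ?. by split; size_lia.
- move=> x /setDP[xX]; rewrite inE => Gx; apply: (mulfI Gx).
  by rewrite mulrCA -!hornerM; apply: fx.
- move=> y /setDP[yY]; rewrite inE => Gy; apply: (mulfI Gy).
  by rewrite mulrCA -!rmorphM; apply: fy.
Qed.

(* At a good row the Sylvester matrix of [E] and [P] drops rank by [deg_X E], so
   a nonzero resultant would have more roots, counted with multiplicity, than
   its degree allows. *)
Lemma quotient_fit_resultant0 (F : finFieldType) (d a : nat)
    (col row : F -> {poly F}) (E P : {poly {poly F}}) (Xs Ys : {set F}) :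
  (3 * a + 2 * d < #|F|)%N -> (1 < size E)%N -> (sizeY E <= size E)%N ->
  quotient_fit d a col row E P Xs Ys -> resultant E P = 0.
Proof.
move=> ltF szE leE [E0 [sP sYP] [cX cY] fx fy].
apply/eqP/negPn/negP => res0.
pose s := enum (Ys :\: [set y | root (lead_coef E) y]).
have lc0 : lead_coef E != 0 by rewrite lead_coef_eq0.
have sizes : (#|F| <= size s + a)%N.
  have -> : size s = #|Ys :\: [set y | root (lead_coef E) y]| by rewrite /s -cardE.
  have := leq_card_setU (~: Ys) [set y | root (lead_coef E) y].
  move=> /leq_of_leqif; rewrite -setCD.
  have := cardsC (Ys :\: [set y | root (lead_coef E) y]).
  have := card_roots_lt lc0; have := max_size_lead_coefXY E. size_lia.
have gYE : (0 < sizeY E)%N by rewrite sizeY_gt0.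
have sYE : (sizeY E <= (sizeY E).-1.+1)%N by lia.
have sYP' : (sizeY P <= ((sizeY E).-1 + d).+1)%N by lia.
have rowE y : y \in s -> (lead_coef E).[y] != 0 /\
    exists c, map_poly (horner_eval y) P = c * map_poly (horner_eval y) E.
  rewrite mem_enum => /setDP[yY]; rewrite inE => rt; split=> //.
  by exists (row y); apply: fy.
have := resultant_root_bound szE sYE sYP' (enum_uniq _) rowE res0.
have : ((size P).-1 <= (size E).-1 + d)%N by size_lia.
have : ((sizeY E).-1 <= (size E).-1)%N by size_lia.
have : ((sizeY E).-1 <= a)%N by size_lia.
have : (2 * a + 2 * d < size s)%N by size_lia.
have : (0 < (size E).-1)%N by size_lia.
(* With [p <= e2 + d], [e1 <= e2] and [e1 <= a], the bound [p * e1 + e2 * (e1 + d)] is at most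
   [e2 * (2 * a + 2 * d)], hence below [e2 * n]. *)
move: (sizeY E).-1 (size P).-1 (size E).-1 (size s) => e1 p e2 n.
clear; nia.
Qed.

Lemma quotient_to_polynomial_fit (F : finFieldType) (d a : nat)
    (col row : F -> {poly F}) (E P : {poly {poly F}}) (Xs Ys : {set F}) :
  (3 * a + 2 * d < #|F|)%N -> quotient_fit d a col row E P Xs Ys ->
  exists Q, polynomial_fit d a col row Q.
Proof.
move=> ltF; have [n] := ubnP (size E + sizeY E).
elim: n col row E P Xs Ys => // n IH.
(* Exchanging the variables, one may assume that [E] has its larger degree in the outer variable. *)
suff main col row (E P : {poly {poly F}}) Xs Ys : (size E + sizeY E < n.+1)%N ->
    (sizeY E <= size E)%N -> quotient_fit d a col row E P Xs Ys ->
    exists Q, polynomial_fit d a col row Q.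
  move=> col row E P Xs Ys; have [le|lt] := leqP (sizeY E) (size E).
    by move=> ltn; apply: main.
  move=> ltn /quotient_fit_swap fit.
  have := main _ _ _ _ _ _ _ _ fit; rewrite (sizeYE (swapXY E)) swapXYK -sizeYE.
  rewrite addnC => /(_ ltn (ltnW lt))[Q /polynomial_fit_swap fQ].
  by exists (swapXY Q).
move=> ltn leE fit; have [szE|szE] := ltnP 1 (size E).
  have [G [H [K [szG eqE eqP]]]] :=
    resultant0_common_factor (quotient_fit_resultant0 ltF szE leE fit).
  have [E0 _ _ _ _] := fit.
  move: (E0); rewrite eqE mulf_eq0 negb_or => /andP[G0 H0].
  move: fit ltn; rewrite eqE eqP => /quotient_fit_div[Xs' [Ys' fit]].
  rewrite size_mul // sizeY_mul // => ltn.
  apply: IH fit; move: G0 H0; rewrite -!sizeY_gt0; size_lia.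
(* Both degrees of [E] are now zero, so [E] is a nonzero constant [k] and [P / k] is the polynomial
   sought. *)
have [E0 [sP sYP] [cX cY] fx fy] := fit.
have EC : E = (E`_0)%:P by apply: size1_polyC.
have [k k0 Ek] : exists2 k : F, k != 0 & E = k%:P%:P.
  exists E`_0`_0.
    apply: contraNneq E0 => k0; rewrite EC polyC_eq0 -size_poly_eq0.
    rewrite -leqn0; apply/leq_sizeP => -[|i] //= _; rewrite nth_default //.
    by have := max_size_coefXY E 0; size_lia.
  rewrite {1}EC; congr (_%:P); apply: size1_polyC.
  by have := max_size_coefXY E 0; size_lia.
have gE : (0 < size E)%N by rewrite size_poly_gt0.
have gYE : (0 < sizeY E)%N by rewrite sizeY_gt0.
have kk : k^-1%:P * k%:P = 1 :> {poly F} by rewrite -polyCM mulVf.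
exists (k^-1%:P *: P); split.
- by apply: leq_trans (size_scale_leq _ _) _; size_lia.
- rewrite sizeYE linearZ /= map_polyC /= mul_polyC.
  by apply: leq_trans (size_scale_leq _ _) _; rewrite -sizeYE; size_lia.
- apply: leq_trans (_ : #|~: Xs| <= a)%N; last by size_lia.
  apply: subset_leq_card; apply/subsetP => x; rewrite !inE; apply: contra => xX.
  by rewrite hornerZ fx // Ek hornerC mulrCA kk mulr1.
- apply: leq_trans (_ : #|~: Ys| <= a)%N; last by size_lia.
  apply: subset_leq_card; apply/subsetP => y; rewrite !inE; apply: contra => yY.
  rewrite linearZ /= {1}/horner_eval hornerC fy // Ek map_polyC /=.
  by rewrite /horner_eval hornerC -mul_polyC mulrCA kk mulr1.
Qed.

(** * Interpolation on a grid *)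

Lemma lagrange_basis (F : fieldType) (s : seq F) : uniq s ->
  exists L : F -> {poly F}, forall x, x \in s ->
    (size (L x) <= size s)%N /\ forall y, y \in s -> (L x).[y] = (x == y)%:R.
Proof.
move=> us; pose M x := \prod_(z <- rem x s) ('X - z%:P).
exists (fun x => (M x).[x]^-1 *: M x) => x xs; split=> [|y ys].
  apply: leq_trans (size_scale_leq _ _) _.
  by rewrite size_prod_XsubC size_rem // prednK // lt0n size_eq0; case: (s) xs.
have Mx z : (z \in s) -> ((M x).[z] == 0) = (x != z).
  move=> zs; rewrite -[_ == 0]/(root _ _) root_prod_XsubC mem_rem_uniq // inE /=.
  by rewrite zs andbT eq_sym.
rewrite hornerZ; have [<-|nxy] := eqVneq x y.
  by rewrite mulVf // Mx // eqxx.
by have := Mx y ys; rewrite nxy => /eqP ->; rewrite mulr0.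
Qed.

Lemma eq_poly_horner (F : fieldType) (s : seq F) (p r : {poly F}) :
  uniq s -> (size p <= size s)%N -> (size r <= size s)%N ->
  (forall x, x \in s -> p.[x] = r.[x]) -> p = r.
Proof.
move=> us sp sr eqpr; apply/eqP; rewrite -subr_eq0; apply/negPn/negP => nz.
have := max_poly_roots nz _ us; rewrite ltnNge => /(_ _)/negP.
case=> [|]; last first.
  apply: leq_trans (size_polyD _ _) _; rewrite size_polyN geq_max.
  by rewrite sp sr.
by apply/allP => x xs; rewrite /root hornerD hornerN eqpr // subrr.
Qed.

(* Pigeonhole: there are more coefficient matrices than value tables on [S]. *)
Lemma error_locator (F : finFieldType) (a : nat) (S : {set F * F}) :
  (#|S| < a.+1 ^ 2)%N ->
  exists E : {poly {poly F}},
    [/\ E != 0, (size E <= a.+1)%N, (sizeY E <= a.+1)%N &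
        forall z, z \in S -> E.[z.1, z.2] = 0].
Proof.
move=> ltS.
pose pol (W : 'M[F]_a.+1) : {poly {poly F}} :=
  \poly_(i < a.+1) (\poly_(j < a.+1) W (inord i) (inord j)).
pose val (W : 'M[F]_a.+1) : {ffun {z | z \in S} -> F} :=
  [ffun z => (pol W).[(sval z).1, (sval z).2]].
have : ~~ injectiveb val.
  apply: contraL ltS => /injectiveP/leq_card; rewrite card_mx card_ffun card_sig.
  by rewrite leq_exp2l ?card_finRing_gt1 // -leqNgt mulnn.
case/injectivePn => W1 [W2 neq eqv].
have polB i j : (i < a.+1)%N -> (j < a.+1)%N ->
    (pol W1 - pol W2)`_i`_j = W1 (inord i) (inord j) - W2 (inord i) (inord j).
  by move=> lti ltj; rewrite !coefB !coef_poly lti !coef_poly ltj.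
exists (pol W1 - pol W2); split.
- apply: contraNneq neq => e; apply/eqP/matrixP => i j.
  have := polB i j (ltn_ord i) (ltn_ord j); rewrite e !coef0 !inord_val.
  by move/esym/eqP; rewrite subr_eq0 => /eqP.
- by apply: leq_trans (size_polyD _ _) _; rewrite size_polyN geq_max !size_poly.
- apply/bigmax_leqP => i _; rewrite coefB.
  apply: leq_trans (size_polyD _ _) _; rewrite size_polyN geq_max.
  by rewrite !coef_poly; case: ifP; rewrite ?size_poly0 ?size_poly.
- move=> z zS; have /ffunP/(_ (exist _ z zS)) := eqv.
  by rewrite !ffunE /= !hornerE => ->; rewrite subrr.
Qed.

Lemma horner_map_eval (F : comNzRingType) (E : {poly {poly F}}) (x y : F) :
  (map_poly (horner_eval y) E).[x] = E.[x, y].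
Proof. by rewrite -horner_swapXY horner2_swapXY. Qed.

(** After multiplication by an [E] that vanishes at the disagreements, rows and columns agree on the
    whole grid. Interpolating the products [col x * E] along enough columns gives [P]; degree counts
    then extend the identity to all rows, and from these to all columns. *)
Lemma grid_polynomial_fit (F : finFieldType) (d a : nat)
    (col row : F -> {poly F}) :
  (forall x, size (col x) <= d.+1)%N -> (forall y, size (row y) <= d.+1)%N ->
  (#|[set z : F * F | (col z.1).[z.2] != (row z.2).[z.1]]| < a.+1 ^ 2)%N ->
  (3 * a + 2 * d < #|F|)%N -> exists Q, polynomial_fit d a col row Q.
Proof.
move=> scol srow ltS ltF.
have [E [E0 sE sYE ES]] := error_locator ltS.
have gE : (0 < size E)%N by rewrite size_poly_gt0.
have gYE : (0 < sizeY E)%N by rewrite sizeY_gt0.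
have eqE x y : (col x).[y] * E.[x, y] = (row y).[x] * E.[x, y].
  have [->//|ne] := eqVneq (col x).[y] (row y).[x].
  by rewrite (ES (x, y)) ?inE //= !mulr0.
(* Each [row y * E] has size at most [size E + d] in [X], so this many columns determine it. *)
pose s := take (size E + d) (enum F).
have ss : size s = (size E + d)%N.
  by rewrite size_takel // -cardE; size_lia.
have us : uniq s by rewrite take_uniq // enum_uniq.
have [L Ls] := lagrange_basis us.
pose P : {poly {poly F}} :=
  \sum_(x <- s) (map_poly polyC (L x)) * (col x * E.[x%:P])%:P.
have sP : (size P <= size E + d)%N.
  rewrite -ss /P big_seq; apply: leq_trans (size_sum _ _ _) _.
  apply/bigmax_leqP_seq => x xs _; rewrite mulrC mul_polyC.
  apply: leq_trans (size_scale_leq _ _) _.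
  by rewrite size_map_polyC; case: (Ls x xs).
have scE x : (size (col x * E.[x%:P])%R <= sizeY E + d)%N.
  apply: leq_trans (size_polyMleq _ _) _.
  have := scol x; have := max_size_evalC E x; size_lia.
have sYP : (sizeY P <= sizeY E + d)%N.
  apply/bigmax_leqP => i _; rewrite /P coef_sum.
  apply: leq_trans (size_sum _ _ _) _; apply/bigmax_leqP_seq => x _ _.
  rewrite coefMC coef_map /= mul_polyC.
  exact: leq_trans (size_scale_leq _ _) _.
have Prow y : map_poly (horner_eval y) P = row y * map_poly (horner_eval y) E.
  apply: (eq_poly_horner us) => [||x xs].
  - by rewrite ss; apply: leq_trans (size_poly _ _) sP.
  - rewrite ss; apply: leq_trans (size_polyMleq _ _) _.
    have := srow y; have : (size (map_poly (horner_eval y) E) <= size E)%N.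
      exact: size_poly.
    size_lia.
  rewrite hornerM !horner_map_eval -eqE /P.
  rewrite !horner_sum (bigD1_seq x) //= big1_seq => [|z /andP[nzx zs]].
    rewrite addr0 hornerM hornerC horner_map /= hornerM hornerC hornerM.
    by have [_ ->] := Ls x xs; rewrite // eqxx mul1r.
  rewrite hornerM hornerC horner_map /= hornerM hornerC.
  by have [_ ->] := Ls z zs; rewrite // (negPf nzx) mul0r.
have Pcol x : P.[x%:P] = col x * E.[x%:P].
  apply: (@eq_poly_horner _ (enum F)) => [||| y _].
  - exact: enum_uniq.
  - rewrite -cardE; apply: leq_trans (max_size_evalC _ _) _; size_lia.
  - rewrite -cardE; apply: leq_trans (scE _) _; size_lia.
  by rewrite -horner_map_eval Prow !hornerM horner_map_eval eqE.
apply: (@quotient_to_polynomial_fit _ _ _ _ _ E P setT setT) => //.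
by split=> //; rewrite setCT cards0 !add0n.
Qed.

(** * Lines, decoded polynomials and the count of rejections *)

Lemma card_sumb (T : finType) (b : pred T) :
  #|[set x | b x]| = (\sum_x b x)%N.
Proof. by rewrite -sum1dep_card big_mkcond; apply: eq_bigr => x _; case: (b x). Qed.

Lemma line_of_shift (F : finFieldType) (m : nat) (a w : 'rV[F]_m) (t : F) :
  line_of (a + t *: w) w = line_of a w.
Proof.
apply/setP => x; apply/imsetP/imsetP => -[s _ ->].
  by exists (t + s) => //; rewrite scalerDl addrA.
by exists (s - t) => //; rewrite scalerBl addrA addrAC addrK addrC.
Qed.

Lemma line_of_scale (F : finFieldType) (m : nat) (a w : 'rV[F]_m) (c : F) :
  c != 0 -> line_of a (c *: w) = line_of a w.
Proof.
move=> c0; apply/setP => x; apply/imsetP/imsetP => -[s _ ->].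
  by exists (s * c) => //; rewrite scalerA.
by exists (s / c) => //; rewrite scalerA divfK.
Qed.

Lemma line_of_inj (F : finFieldType) (m : nat) (a u w : 'rV[F]_m) :
  u != 0 -> line_of a u = line_of a w -> exists2 c, c != 0 & u = c *: w.
Proof.
move=> u0 eql; have : a + u \in line_of a w.
  by rewrite -eql; apply/imsetP; exists 1; rewrite ?scale1r.
case/imsetP => c _ /addrI eqc; exists c => //.
by apply: contraNneq u0 => c0; rewrite eqc c0 scale0r.
Qed.

(** The decoder may use another base point and direction for the same line; the change of parameter
    is affine and preserves the degree. *)
Lemma decoder_line_poly (F : finFieldType) (m d : nat) (f : 'rV[F]_m -> F)
    (P : {set 'rV[F]_m} -> 'rV[F]_m -> F) (a w : 'rV[F]_m) :
  best_line_decoder d f P -> w != 0 ->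
  exists2 p : {poly F}, (size p <= d.+1)%N &
    forall t, P (line_of a w) (a + t *: w) = p.[t].
Proof.
move=> best w0.
have [[b [u [p [u0 eql sp Pp]]]] _] := best (line_of a w) (ex_intro _ a
  (ex_intro _ w (conj w0 erefl))).
have : a \in line_of b u.
  by rewrite -eql; apply/imsetP; exists 0; rewrite // scale0r addr0.
case/imsetP => s _ eqa.
have /(line_of_inj w0)[c c0 eqw] : line_of a w = line_of a u.
  by rewrite eql eqa line_of_shift.
exists (p \Po (c *: 'X + s%:P)) => [|t].
  apply: leq_trans sp; rewrite size_comp_poly2 //.
  by rewrite size_polyDl size_scale ?size_polyX // ltnS size_polyC_leq1.
rewrite horner_comp !hornerE -Pp; congr (P _ _).
by rewrite {1}eqa eqw -addrA scalerA -scalerDl addrC [c * t]mulrC [s + _]addrC addrC.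
Qed.

Lemma agree_on_line (F : finFieldType) (m : nat) (a w : 'rV[F]_m)
    (f g : 'rV[F]_m -> F) : w != 0 ->
  agree_on (line_of a w) f g = #|[set t | g (a + t *: w) == f (a + t *: w)]|.
Proof.
move=> w0; rewrite -(card_imset _ (_ : injective (fun t : F => a + t *: w))).
  apply: eq_card => x; rewrite inE; apply/andP/imsetP => [[]|[t]].
    by case/imsetP=> t _ -> gf; exists t; rewrite ?inE.
  by rewrite inE => gf ->; split=> //; apply/imsetP; exists t.
move=> s t /addrI /eqP; rewrite -subr_eq0 -scalerBl scaler_eq0 (negPf w0) orbF.
by rewrite subr_eq0 => /eqP.
Qed.

Lemma decoder_best_on_line (F : finFieldType) (m d : nat) (f : 'rV[F]_m -> F)
    (P : {set 'rV[F]_m} -> 'rV[F]_m -> F) (a w : 'rV[F]_m) (g : 'rV[F]_m -> F)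
    (p : {poly F}) :
  best_line_decoder d f P -> w != 0 -> (size p <= d.+1)%N ->
  (forall t, g (a + t *: w) = p.[t]) ->
  (#|[set t | (g (a + t *: w) == f (a + t *: w))%R]| <=
   #|[set t | (P (line_of a w) (a + t *: w) == f (a + t *: w))%R]|)%N.
Proof.
move=> best w0 sp gp; rewrite -!agree_on_line //.
have [|_] := best (line_of a w); first by exists a, w.
by apply; exists a, w, p.
Qed.

(** A line through [a] has exactly [#|F|.-1] direction vectors, so a uniform line may be replaced by
    a uniform nonzero direction. *)
Lemma card_directions (F : finFieldType) (m : nat) (a : 'rV[F]_m)
    (b : pred {set 'rV[F]_m}) :
  #|[set w | (w != 0) && b (line_of a w)]| =
  (#|F|.-1 * #|[set L in lines_through a | b L]|)%N.
Proof.
rewrite -sum1_card (partition_big (line_of a)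
  (fun L => L \in [set L in lines_through a | b L])) /=; last first.
  move=> w; rewrite inE => /andP[w0 bw]; rewrite !inE bw andbT.
  by apply/existsP; exists w; rewrite w0 eqxx.
rewrite mulnC -sum_nat_const; apply: eq_bigr => L; rewrite inE => /andP[].
rewrite inE => /existsP[u /andP[u0 /eqP ->]] bu.
rewrite sum1dep_card.
transitivity #|[set c *: u | c in [set c : F | c != 0]]|; last first.
  rewrite card_imset; last first.
    move=> s t /eqP; rewrite -subr_eq0 -scalerBl scaler_eq0 (negPf u0) orbF.
    by rewrite subr_eq0 => /eqP.
  by have := cardsC1 (0 : F) => <-; apply: eq_card => c; rewrite !inE.
apply: eq_card => w; rewrite !inE.
apply/idP/imsetP => [/andP[/andP[w0 _] /eqP] /(line_of_inj w0)[c c0 ->]|[c]].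
  by exists c; rewrite ?inE.
rewrite inE => c0 ->; rewrite line_of_scale // eqxx scaler_eq0 (negPf c0).
by rewrite (negPf u0) bu.
Qed.

Definition rejections (F : finFieldType) (f : 'rV[F]_2 -> F)
    (P : {set 'rV[F]_2} -> 'rV[F]_2 -> F) (w : 'rV[F]_2) : nat :=
  #|[set a | P (line_of a w) a != f a]|.

Lemma card_plane (F : finFieldType) : #|'rV[F]_2| = (#|F| ^ 2)%N.
Proof. by rewrite card_mx mul1n. Qed.

Lemma card_plane_neq0 (F : finFieldType) :
  #|[set w : 'rV[F]_2 | w != 0]| = (#|F| ^ 2).-1.
Proof.
have := cardsC1 (0 : 'rV[F]_2); rewrite card_plane => <-.
by apply: eq_card => w; rewrite !inE.
Qed.

Lemma accepted_rejected (F : finFieldType) (f : 'rV[F]_2 -> F)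
    (P : {set 'rV[F]_2} -> 'rV[F]_2 -> F) (a : 'rV[F]_2) :
  (#|[set w | (w != 0%R) && (P (line_of a w) a == f a)]| +
   \sum_(w | w != 0%R) (P (line_of a w) a != f a) = (#|F| ^ 2).-1)%N.
Proof.
rewrite -card_plane_neq0 -sum1dep_card big_mkcondr -sum1dep_card -big_split /=.
by apply: eq_bigr => w _; case: (_ == _).
Qed.

Lemma sum_rejections (F : finFieldType) (f : 'rV[F]_2 -> F)
    (P : {set 'rV[F]_2} -> 'rV[F]_2 -> F) :
  (\sum_(w | w != 0%R) rejections f P w =
   \sum_a \sum_(w | w != 0%R) (P (line_of a w) a != f a))%N.
Proof.
by rewrite exchange_big; apply: eq_bigr => w _; rewrite /rejections card_sumb.
Qed.

Lemma ldt_rejections (R : realFieldType) (F : finFieldType) (delta : R)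
    (f : 'rV[F]_2 -> F) (P : {set 'rV[F]_2} -> 'rV[F]_2 -> F) :
  1 - delta <= ldt_accept_prob R f P ->
  (\sum_(w | w != 0%R) rejections f P w)%N%:R
    <= delta * (#|F| ^ 2 * (#|F| ^ 2).-1)%N%:R.
Proof.
have q1 : (1 < #|F|)%N := card_finRing_gt1 F.
have q2 : (0 < (#|F| ^ 2).-1)%N by nia.
pose A a := #|[set w | (w != 0) && (P (line_of a w) a == f a)]|.
have ratio a : #|[set L in lines_through a | P L a == f a]|%:R /
    #|lines_through a|%:R = (A a)%:R / (#|F| ^ 2).-1%:R :> R.
  rewrite /A (card_directions a (fun L => P L a == f a)) -card_plane_neq0.
  have -> : [set w : 'rV[F]_2 | w != 0] =
      [set w | (w != 0) && predT (line_of a w)].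
    by apply/setP => w; rewrite !inE andbT.
  rewrite (card_directions a predT).
  have -> : [set L in lines_through a | predT L] = lines_through a.
    by apply/setP => L; rewrite inE andbT.
  rewrite !natrM -mulf_div divff ?mul1r // pnatr_eq0; lia.
rewrite /ldt_accept_prob (eq_bigr _ (fun a _ => ratio a)) -mulr_suml card_plane.
have sumA : (\sum_a A a + \sum_(w | w != 0%R) rejections f P w =
    #|F| ^ 2 * (#|F| ^ 2).-1)%N.
  rewrite sum_rejections -big_split /=.
  rewrite (eq_bigr _ (fun a _ => accepted_rejected f P a)).
  by rewrite sum_nat_const card_plane.
move: q2; rewrite -natr_sum.
move: (\sum_a A a)%N (\sum_(w | w != 0%R) rejections f P w)%N sumA => S N.
move: (#|F| ^ 2)%N => k sumA q2.
have kR : 0 < (k * k.-1)%N%:R :> R by rewrite ltr0n; nia.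
rewrite mulrCA -invfM -natrM ler_pdivlMr // mulrBl mul1r lerBlDr.
by rewrite -{1}sumA natrD lerD2l.
Qed.

(** * The case of degree zero *)

Lemma constant_test (F : finFieldType) (f : 'rV[F]_2 -> F)
    (P : {set 'rV[F]_2} -> 'rV[F]_2 -> F) :
  best_line_decoder 0 f P -> exists c,
    (#|[set x | f x != c]| * (#|F| ^ 2).-1 <=
     2 * \sum_(w | w != 0%R) rejections f P w)%N.
Proof.
move=> best; pose B c := #|[set x | f x != c]|.
case: (@arg_minnP F 0 xpredT B) => // c _ minc; exists c.
(* [c] minimises the number of errors, so for every [a] at least [B c] shifts [w] change the value
   [f a]. *)
have le1 : (#|F| ^ 2 * B c <= \sum_a \sum_w (f (a + w)%R != f a))%N.
  rewrite -card_plane -sum_nat_const; apply: leq_sum => a _.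
  apply: leq_trans (minc (f a) isT) _; rewrite /B card_sumb.
  by rewrite (reindex_inj (addrI a)).
have le2 : (\sum_a \sum_w (f (a + w)%R != f a) <=
    2 * \sum_(w | w != 0%R) rejections f P w)%N.
  rewrite exchange_big (bigD1 0) //= big1 => [|a _]; last by rewrite addr0 eqxx.
  rewrite add0n big_distrr /=; apply: leq_sum => w w0.
  (* One copy of the rejections is counted at [a] and the other, after translation, at [a + w]; both
     points lie on the same line in direction [w]. *)
  rewrite mul2n -addnn {2}/rejections /rejections !card_sumb.
  rewrite [X in (_ <= _ + X)%N](reindex_inj (addIr w)) -big_split.
  apply: leq_sum => a _ /=.
  have [p sp Pp] := decoder_line_poly a best w0.
  have -> : line_of (a + w) w = line_of a w.
    by rewrite -{1}[w]scale1r line_of_shift.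
  have /size1_polyC pC := sp.
  have := Pp 0; have := Pp 1; rewrite pC !hornerC scale0r addr0 scale1r => -> ->.
  have [<-|_] := eqVneq p`_0 (f a); first by rewrite eq_sym.
  by case: (_ != _).
have := leq_trans le1 le2; rewrite -/(B c).
by apply: leq_trans; rewrite mulnC leq_mul2r leq_pred orbT.
Qed.

(** * Lines through the error points of a close polynomial *)

Lemma card_line_sum (F : finFieldType) (w : 'rV[F]_2) (b : pred 'rV[F]_2) :
  (\sum_a #|[set t | b (a + t *: w)%R]| = #|F| * #|[set a | b a]|)%N.
Proof.
under eq_bigr => a _ do rewrite card_sumb.
rewrite exchange_big -sum_nat_const; apply: eq_bigr => t _ /=.
by rewrite card_sumb [RHS](reindex_inj (addIr (t *: w))).
Qed.

Lemma card_poly_agree (F : finFieldType) (p r : {poly F}) (n : nat) :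
  p != r -> (size p <= n.+1)%N -> (size r <= n.+1)%N ->
  (#|[set t | p.[t] == r.[t]]| <= n)%N.
Proof.
move=> npr sp sr; have nz : p - r != 0 by rewrite subr_eq0.
have -> : [set t | p.[t] == r.[t]] = [set t | root (p - r) t].
  by apply/setP => t; rewrite !inE /root hornerD hornerN subr_eq0.
rewrite -ltnS; apply: leq_trans (card_roots_lt nz) _.
by apply: leq_trans (size_polyD _ _) _; rewrite size_polyN geq_max sp sr.
Qed.

(* A line through a point where [f] and [g] differ can only be accepted there
   when half of its points are errors. *)
Lemma accepted_error_line (F : finFieldType) (d : nat) (f g : 'rV[F]_2 -> F)
    (P : {set 'rV[F]_2} -> 'rV[F]_2 -> F) (a w : 'rV[F]_2) (p : {poly F}) :
  best_line_decoder d f P -> w != 0 -> (size p <= d.+1)%N ->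
  (forall t, g (a + t *: w) = p.[t]) -> f a != g a -> P (line_of a w) a = f a ->
  (#|F| <= d + 2 * #|[set t | f (a + t *: w)%R != g (a + t *: w)%R]|)%N.
Proof.
move=> best w0 sp gp fga Pfa.
have [r sr Pr] := decoder_line_poly a best w0.
have := decoder_best_on_line best w0 sp gp.
set Ag := [set t | _ == _]; set AP := [set t | _ == _] => leAg.
have npr : p != r.
  apply: contraNneq fga => epr; have := gp 0; have := Pr 0.
  by rewrite scale0r addr0 epr => <- ->; rewrite Pfa.
(* [Ag] is no larger than [AP] and meets it in at most [d] points, so [2 * #|Ag| <= #|F| + d]; the
   errors form the complement of [Ag]. *)
have := card_poly_agree npr sp sr.
have : (#|Ag :&: AP| <= #|[set t | p.[t] == r.[t]]|)%N.
  apply: subset_leq_card; apply/subsetP => t; rewrite !inE gp Pr.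
  by case/andP => /eqP -> /eqP ->.
have := cardsUI Ag AP; have := max_card (mem (Ag :|: AP)).
have := cardsC Ag.
have -> : ~: Ag = [set t | f (a + t *: w) != g (a + t *: w)].
  by apply/setP => t; rewrite !inE eq_sym.
move: leAg; size_lia.
Qed.

(** Accepted directions see errors on about half of their line, whereas on average a line through
    [a] has an error rate of at most about one fifth. So at most half of the directions can be
    accepted. *)
Lemma accepted_error_point (F : finFieldType) (d : nat) (f g : 'rV[F]_2 -> F)
    (P : {set 'rV[F]_2} -> 'rV[F]_2 -> F) (a : 'rV[F]_2) :
  best_line_decoder d f P ->
  (forall b w, exists2 p : {poly F}, (size p <= d.+1)%N &
     forall t, g (b + t *: w) = p.[t]) ->
  (5 * #|[set x | f x != g x]| <= #|F| ^ 2)%N -> (5 * d + 20 < #|F|)%N ->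
  f a != g a ->
  (2 * #|[set w | (w != 0%R) && (P (line_of a w) a == f a)]|
     <= (#|F| ^ 2).-1)%N.
Proof.
move=> best glow B5 qd fga; set A := [set w | _].
pose b w := #|[set t | f (a + t *: w) != g (a + t *: w)]|.
have le1 : (#|A| * #|F| <= #|A| * d + 2 * \sum_(w in A) b w)%N.
  rewrite -!sum_nat_const big_distrr -big_split /=; apply: leq_sum => w.
  rewrite inE => /andP[w0 /eqP Pfa]; have [p sp gp] := glow a w.
  exact: accepted_error_line sp gp fga Pfa.
have le2 : (\sum_(w in A) b w <= \sum_w b w)%N.
  by rewrite [X in (_ <= X)%N](bigID (mem A)) /= leq_addr.
(* The parameter [t = 0] meets the error at [a] once per direction; for each other [t], the map
   [w |-> a + t *: w] permutes the plane. *)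
have eq3 : (\sum_w b w = #|F| ^ 2 + #|F|.-1 * #|[set x | f x != g x]|)%N.
  under eq_bigr => w _ do rewrite /b card_sumb.
  rewrite exchange_big (bigD1 0) //=; congr (_ + _)%N.
    rewrite (eq_bigr (fun=> 1%N)) => [|w _]; last by rewrite scale0r addr0 fga.
    by rewrite sum1_card card_plane.
  rewrite (eq_bigr (fun=> #|[set x | f x != g x]|)) => [|t t0].
    rewrite sum_nat_const; congr (_ * _)%N.
    by have := cardC1 (0 : F) => <-; apply: eq_card => t; rewrite !inE.
  rewrite card_sumb [RHS](reindex_inj (_ : injective (fun w => a + t *: w))) //.
  move=> w1 w2 /addrI /eqP; rewrite -subr_eq0 -scalerBr scaler_eq0 (negPf t0).
  by rewrite subr_eq0 => /eqP.
move: le1 le2 eq3 B5 qd; set B := #|[set x | _]|.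
move: (\sum_(w in A) _)%N (\sum_w _)%N => s1 s2.
move: #|A| #|F| B => k q B; clear.
rewrite leqNgt => le1 le2 eq3 B5 qd; apply/negP => ltk.
have q2k : (q ^ 2 <= 2 * k)%N by lia.
(* Since [q - d > 4 * q / 5 + 4] and [B <= q ^ 2 / 5], this forces [2 * k <= q ^ 2]; the slack [20]
   absorbs the contribution of [t = 0]. *)
have : (k * (q - d) <= 2 * (q ^ 2 + q.-1 * B))%N by nia.
nia.
Qed.

Lemma close_imp_closer (F : finFieldType) (d : nat) (f g : 'rV[F]_2 -> F)
    (P : {set 'rV[F]_2} -> 'rV[F]_2 -> F) :
  best_line_decoder d f P ->
  (forall b w, exists2 p : {poly F}, (size p <= d.+1)%N &
     forall t, g (b + t *: w) = p.[t]) ->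
  (5 * #|[set x | f x != g x]| <= #|F| ^ 2)%N -> (5 * d + 20 < #|F|)%N ->
  (#|[set x | f x != g x]| * (#|F| ^ 2).-1 <=
     2 * \sum_(w | w != 0%R) rejections f P w)%N.
Proof.
move=> best glow B5 qd; rewrite sum_rejections -sum_nat_const.
rewrite big_distrr [X in (_ <= X)%N](bigID (fun x => x \in [set x | f x != g x])).
apply: leq_trans (leq_addr _ _); apply: leq_sum => a; rewrite inE => fga.
have := accepted_error_point best glow B5 qd fga.
by have := accepted_rejected f P a; rewrite /=; lia.
Qed.

(** * Coordinates along two directions and approximation in bidegree [(d, d)] *)

Definition det2 (F : fieldType) (u v : 'rV[F]_2) : F :=
  u 0 0 * v 0 1 - u 0 1 * v 0 0.

(** Cramer's rule for the first coordinate of [x] in the basis [u], [v]; [coord2] gives the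
    second. *)
Definition coord1 (F : fieldType) (u v x : 'rV[F]_2) : F := det2 x v / det2 u v.

Definition coord2 (F : fieldType) (u v x : 'rV[F]_2) : F := det2 u x / det2 u v.

Lemma eq_row2 (F : fieldType) (x y : 'rV[F]_2) :
  x 0 0 = y 0 0 -> x 0 1 = y 0 1 -> x = y.
Proof.
move=> e0 e1; apply/rowP => -[[|[|//]] lti].
  by rewrite (_ : Ordinal lti = 0) //; apply: val_inj.
by rewrite (_ : Ordinal lti = 1) //; apply: val_inj.
Qed.

Lemma coordK (F : fieldType) (u v x : 'rV[F]_2) : det2 u v != 0 ->
  coord1 u v x *: u + coord2 u v x *: v = x.
Proof.
by move=> D0; apply: eq_row2; rewrite !mxE /coord1 /coord2;
  move: D0; rewrite /det2 => D0; field.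
Qed.

Lemma coord1_point (F : fieldType) (u v : 'rV[F]_2) (s t : F) :
  det2 u v != 0 -> coord1 u v (s *: u + t *: v) = s.
Proof.
by rewrite /coord1 /det2 !mxE => D0; field.
Qed.

Lemma coord2_point (F : fieldType) (u v : 'rV[F]_2) (s t : F) :
  det2 u v != 0 -> coord2 u v (s *: u + t *: v) = t.
Proof.
by rewrite /coord2 /det2 !mxE => D0; field.
Qed.

Lemma coord1_line (F : fieldType) (u v a w : 'rV[F]_2) (t : F) :
  coord1 u v (a + t *: w) = coord1 u v a + t * coord1 u v w.
Proof. by rewrite /coord1 /det2 !mxE; ring. Qed.

Lemma coord2_line (F : fieldType) (u v a w : 'rV[F]_2) (t : F) :
  coord2 u v (a + t *: w) = coord2 u v a + t * coord2 u v w.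
Proof. by rewrite /coord2 /det2 !mxE; ring. Qed.

Lemma det2_eq0 (F : fieldType) (u w : 'rV[F]_2) : u != 0 -> det2 u w = 0 ->
  exists t, w = t *: u.
Proof.
move=> u0 /eqP; rewrite subr_eq0 => /eqP D0.
have [u00|u00] := eqVneq (u 0 0) 0.
  have u01 : u 0 1 != 0.
    by apply: contraNneq u0 => u01; apply/eqP/eq_row2; rewrite !mxE.
  exists (w 0 1 / u 0 1); apply: eq_row2; rewrite !mxE ?divfK //.
  move: D0; rewrite u00 mul0r mulr0 => /esym/eqP.
  by rewrite mulf_eq0 (negPf u01) => /eqP.
exists (w 0 0 / u 0 0); apply: eq_row2; rewrite !mxE ?divfK //.
by rewrite mulrAC [w 0 0 * _]mulrC -D0 mulrAC divff // mul1r.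
Qed.

Lemma sum_coord (F : finFieldType) (u v : 'rV[F]_2) (b : 'rV[F]_2 -> nat) :
  det2 u v != 0 ->
  (\sum_a b a = \sum_y \sum_x b (x *: u + y *: v)%R)%N.
Proof.
move=> D0; rewrite exchange_big pair_big /=.
rewrite (reindex (fun z : F * F => z.1 *: u + z.2 *: v)) //.
apply: onW_bij; exists (fun x => (coord1 u v x, coord2 u v x)) => [[s t]|x].
  by rewrite /= coord1_point // coord2_point.
by rewrite /= coordK.
Qed.

(** With fewer than [q] good directions, at least [q * (q - 1)] would be bad, and at
    [q * (q + 1) / 100] rejections each they would exhaust the bound. A one-dimensional subspace has
    only [q - 1] nonzero vectors, so [q] good ones include two independent ones. *)
Lemma two_good_directions (F : finFieldType) (f : 'rV[F]_2 -> F)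
    (P : {set 'rV[F]_2} -> 'rV[F]_2 -> F) :
  (100 * \sum_(w | w != 0%R) rejections f P w < #|F| ^ 2 * (#|F| ^ 2).-1)%N ->
  exists u v, [/\ det2 u v != 0,
    (100 * rejections f P u < #|F| * #|F|.+1)%N &
    (100 * rejections f P v < #|F| * #|F|.+1)%N].
Proof.
move=> ltN; have q1 : (1 < #|F|)%N := card_finRing_gt1 F.
pose good w := (100 * rejections f P w < #|F| * #|F|.+1)%N.
pose T := [set w | (w != 0) && good w].
pose T' := [set w | (w != 0) && ~~ good w].
have TT' : (#|T| + #|T'| = (#|F| ^ 2).-1)%N.
  rewrite -card_plane_neq0 -[RHS](cardsID [set w | good w]); congr (_ + _)%N.
    by apply: eq_card => w; rewrite !inE.
  by apply: eq_card => w; rewrite !inE andbC.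
have leT' : (#|T'| * (#|F| * #|F|.+1) <=
    100 * \sum_(w | w != 0%R) rejections f P w)%N.
  rewrite -sum_nat_const big_distrr /= [X in (_ <= X)%N](bigID good) /=.
  apply: leq_trans (leq_addl _ _).
  rewrite [X in (X <= _)%N](eq_bigl (fun w => (w != 0) && ~~ good w)) => [|w].
    by apply: leq_sum => w /andP[_]; rewrite /good -leqNgt.
  by rewrite inE.
have geT : (#|F| <= #|T|)%N.
  move: leT' TT' ltN q1; move: (\sum_(w | _) _)%N #|T| #|T'| #|F| => N t t' q.
  clear; move=> leT' TT' ltN q1; rewrite leqNgt; apply/negP => ltq.
  have : (q * q.-1 <= t')%N by nia.
  nia.
have /card_gt0P[u uT] : (0 < #|T|)%N by lia.
have /andP[u0 gu] : (u != 0) && good u by move: uT; rewrite inE.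
have : ~~ (T \subset [set t *: u | t in [set~ 0]]).
  apply/negP => /subset_leq_card /(leq_trans geT).
  move/leq_trans/(_ (leq_imset_card _ _)); rewrite cardsC1; size_lia.
case/subsetPn => v; rewrite inE => /andP[v0 gv] /imsetP nv.
exists u, v; split=> //; apply/eqP => /(det2_eq0 u0)[t vt].
apply: nv; exists t => //; rewrite !inE.
by apply: contraNneq v0 => t0; rewrite vt t0 scale0r.
Qed.

Lemma close_to_bidegree (F : finFieldType) (d : nat) (f : 'rV[F]_2 -> F)
    (P : {set 'rV[F]_2} -> 'rV[F]_2 -> F) :
  best_line_decoder d f P -> (0 < d)%N -> (1000 * d < #|F|)%N ->
  (100 * \sum_(w | w != 0%R) rejections f P w < #|F| ^ 2 * (#|F| ^ 2).-1)%N ->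
  exists u v (Q : {poly {poly F}}),
    [/\ det2 u v != 0, (size Q <= d.+1)%N, (sizeY Q <= d.+1)%N &
        (100 * #|[set x | f x != Q.[coord1 u v x, coord2 u v x]]|
          <= 17 * #|F| ^ 2)%N].
Proof.
move=> best d0 qd /two_good_directions[u [v [D0 ru rv]]].
have u0 : u != 0.
  by apply: contraNneq D0 => ->; rewrite /det2 !mxE !mul0r subr0.
have v0 : v != 0.
  by apply: contraNneq D0 => ->; rewrite /det2 !mxE !mulr0 subr0.
have /fin_all_exists2[row srow Prow] y :=
  decoder_line_poly (y *: v) best u0.
have /fin_all_exists2[col scol Pcol] x :=
  decoder_line_poly (x *: u) best v0.
have ruE : (rejections f P u =
    \sum_y \sum_x ((row y).[x] != f (x *: u + y *: v)%R))%N.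
  rewrite /rejections card_sumb (sum_coord _ D0); apply: eq_bigr => y _.
  apply: eq_bigr => x _; rewrite -Prow [x *: u + _]addrC line_of_shift.
  by rewrite addrC.
have rvE : (rejections f P v =
    \sum_y \sum_x ((col x).[y] != f (x *: u + y *: v)%R))%N.
  rewrite /rejections card_sumb (sum_coord _ D0); apply: eq_bigr => y _.
  by apply: eq_bigr => x _; rewrite -Pcol line_of_shift.
(* [(3q/20)^2] is 2.25 percent of [q^2], above the roughly 2 percent of grid disagreements, while
   [3 * a + 2 * d] stays below [q]. *)
pose a := ((3 * #|F|) %/ 20)%N.
have ltS : (#|[set z : F * F | (col z.1).[z.2] != (row z.2).[z.1]]| < a.+1 ^ 2)%N.
  apply: (@leq_ltn_trans (rejections f P u + rejections f P v)); last first.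
    by rewrite /a; nia.
  rewrite ruE rvE -big_split /= card_sumb.
  rewrite -(pair_bigA _ (fun x y => ((col x).[y] != (row y).[x] : nat))) /=.
  rewrite exchange_big; apply: leq_sum => y _; rewrite -big_split.
  apply: leq_sum => x _ /=.
  have [<-|_] := eqVneq (row y).[x] (f _) => //.
  by case: (_ != _).
have [Q [sQ sYQ _ rowQ]] := grid_polynomial_fit scol srow ltS
  (ltac:(rewrite /a; lia)).
exists u, v, Q; split=> //.
(* On a row where [Q] restricts to [row y], an error of [Q] is a rejection in direction [u]. The at
   most [a] other rows are counted in full, which gives about 1 + 15 percent. *)
have le : (#|[set x | f x != Q.[coord1 u v x, coord2 u v x]]| <=
    rejections f P u + a * #|F|)%N.
  rewrite card_sumb (sum_coord _ D0) ruE.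
  apply: leq_trans (leq_add (leqnn _) (leq_mul rowQ (leqnn _))).
  rewrite card_sumb big_distrl -big_split; apply: leq_sum => y _ /=.
  have [eqy|_] := eqVneq (map_poly (horner_eval y) Q) (row y).
    rewrite mul0n addn0; apply: leq_sum => x _.
    by rewrite coord1_point // coord2_point // -horner_map_eval eqy eq_sym.
  apply: leq_trans (leq_addl _ _); rewrite mul1n -sum1_card.
  by apply: leq_sum => x _; case: (_ != _).
move: le ru qd d0; rewrite /a; nia.
Qed.

(** * Restriction to lines, the top form and the total degree *)

Lemma horner2_coef_wide (F : fieldType) (Q : {poly {poly F}}) (n : nat)
    (x y : F) :
  (size Q <= n)%N -> (sizeY Q <= n)%N ->
  Q.[x, y] = \sum_(i < n) \sum_(j < n) Q`_i`_j * (x ^+ i * y ^+ j).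
Proof.
move=> sQ sYQ; rewrite (horner_coef_wide _ sQ) horner_sum.
apply: eq_bigr => i _; rewrite hornerM -polyC_exp hornerC.
rewrite (horner_coef_wide _ (leq_trans (max_size_coefXY Q i) sYQ)) mulr_suml.
by apply: eq_bigr => j _; rewrite -mulrA [_ ^+ j * _]mulrC.
Qed.

Lemma coefM_top (R : nzRingType) (p r : {poly R}) (m n : nat) :
  (size p <= m.+1)%N -> (size r <= n.+1)%N -> (p * r)`_(m + n) = p`_m * r`_n.
Proof.
move=> sp sr; have ltm : (m < (m + n).+1)%N by rewrite ltnS leq_addr.
rewrite coefM (bigD1 (Ordinal ltm)) //= addKn big1 ?addr0 // => i nim.
have {nim} nim : (i != m :> nat) by apply: contra nim => /eqP e; apply/eqP/val_inj.
have [lt|ge] := ltnP i m.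
  by rewrite [r`__]nth_default ?mulr0 //; have := ltn_ord i; size_lia.
by rewrite [p`__]nth_default ?mul0r //; size_lia.
Qed.

Lemma size_linear_exp (F : fieldType) (s t : F) (n : nat) :
  (size ((s%:P + t *: 'X) ^+ n) <= n.+1)%N.
Proof.
apply: leq_trans (size_poly_exp_leq _ _) _; rewrite ltnS.
have : (size (s%:P + t *: 'X)%R <= 2)%N.
  apply: leq_trans (size_polyD _ _) _; rewrite geq_max.
  rewrite (leq_trans (size_polyC_leq1 _)) //.
  by rewrite (leq_trans (size_scale_leq _ _)) ?size_polyX.
nia.
Qed.

Lemma coef_linear_exp (F : fieldType) (s t : F) (n : nat) :
  ((s%:P + t *: 'X) ^+ n)`_n = t ^+ n.
Proof.
elim: n => [|n IH]; first by rewrite !expr0 coef1.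
rewrite !exprS -[in LHS]add1n coefM_top ?size_linear_exp //.
  by rewrite IH coefD coefC coefZ coefX /= add0r mulr1.
exact: (size_linear_exp s t 1).
Qed.

Definition line_restriction (F : fieldType) (n : nat) (Q : {poly {poly F}})
    (a1 a2 w1 w2 : F) : {poly F} :=
  \sum_(i < n) \sum_(j < n)
     Q`_i`_j *: ((a1%:P + w1 *: 'X) ^+ i * (a2%:P + w2 *: 'X) ^+ j).

Lemma horner_line_restriction (F : fieldType) (n : nat) (Q : {poly {poly F}})
    (a1 a2 w1 w2 t : F) :
  (size Q <= n)%N -> (sizeY Q <= n)%N ->
  (line_restriction n Q a1 a2 w1 w2).[t] = Q.[a1 + t * w1, a2 + t * w2].
Proof.
move=> sQ sYQ; rewrite (horner2_coef_wide _ _ sQ sYQ) horner_sum.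
apply: eq_bigr => i _; rewrite horner_sum; apply: eq_bigr => j _.
by rewrite !hornerE [w1 * t]mulrC [w2 * t]mulrC.
Qed.

Lemma size_linear_monomial (F : fieldType) (a1 a2 w1 w2 : F) (i j : nat) :
  (size ((a1%:P + w1 *: 'X) ^+ i * (a2%:P + w2 *: 'X) ^+ j)%R <= (i + j).+1)%N.
Proof.
apply: leq_trans (size_polyMleq _ _) _.
have := size_linear_exp a1 w1 i; have := size_linear_exp a2 w2 j; size_lia.
Qed.

Lemma size_line_restriction (F : fieldType) (n e : nat) (Q : {poly {poly F}})
    (a1 a2 w1 w2 : F) :
  (forall i j : 'I_n, (e < i + j)%N -> Q`_i`_j = 0) ->
  (size (line_restriction n Q a1 a2 w1 w2) <= e.+1)%N.
Proof.
move=> Q0; apply: leq_trans (size_sum _ _ _) _; apply/bigmax_leqP => i _.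
apply: leq_trans (size_sum _ _ _) _; apply/bigmax_leqP => j _.
have [le|lt] := leqP (i + j) e; last by rewrite Q0 // scale0r size_poly0.
apply: leq_trans (size_scale_leq _ _) _.
exact: leq_trans (size_linear_monomial _ _ _ _ _ _) _.
Qed.

(** The homogeneous part of degree [e] of [Q], grouped by powers of [x] so that it can be read as a
    polynomial in [x] for fixed [y]. *)
Definition top_form (F : fieldType) (n e : nat) (Q : {poly {poly F}}) (x y : F) :=
  \sum_(i < n) (\sum_(j < n | (i + j == e)%N) Q`_i`_j * y ^+ j) * x ^+ i.

Lemma coef_line_restriction (F : fieldType) (n e : nat) (Q : {poly {poly F}})
    (a1 a2 w1 w2 : F) :
  (forall i j : 'I_n, (e < i + j)%N -> Q`_i`_j = 0) ->
  (line_restriction n Q a1 a2 w1 w2)`_e = top_form n e Q w1 w2.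
Proof.
move=> Q0; rewrite coef_sum; apply: eq_bigr => i _; rewrite coef_sum mulr_suml.
rewrite [RHS]big_mkcond; apply: eq_bigr => j _; rewrite coefZ.
have [lt|lt|<-] := ltngtP (i + j)%N e.
- rewrite [X in _ * X]nth_default ?mulr0 //.
  exact: leq_trans (size_linear_monomial _ _ _ _ _ _) lt.
- by rewrite Q0 // mul0r.
rewrite coefM_top ?size_linear_exp // !coef_linear_exp -mulrA.
by rewrite [w1 ^+ i * _]mulrC.
Qed.

(** For fixed [y != 0], the coefficient of [x ^+ i] is the single term [Q_ij * y ^+ j], because
    [i + j = e] determines [j]. So the form is a nonzero polynomial of degree at most [d] in [x]. *)
Lemma card_top_form_neq0 (F : finFieldType) (d e : nat) (Q : {poly {poly F}})
    (i j : 'I_d.+1) (y : F) :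
  (i + j = e)%N -> Q`_i`_j != 0 -> y != 0 ->
  (#|F| - d <= #|[set x | top_form d.+1 e Q x y != 0%R]|)%N.
Proof.
move=> ije Qij y0.
pose p := \poly_(k < d.+1)
  (\sum_(l < d.+1 | ((inord k : 'I_d.+1) + l == e)%N)
     Q`_(inord k : 'I_d.+1)`_l * y ^+ l).
have pE x : p.[x] = top_form d.+1 e Q x y.
  by rewrite horner_poly; apply: eq_bigr => k _; rewrite inord_val.
have p0 : p != 0.
  apply: contraNneq Qij => p0; have := congr1 (fun r : {poly F} => r`_i) p0.
  rewrite coef0 coef_poly ltn_ord inord_val (bigD1 j) /=; last by rewrite ije.
  rewrite big1 ?addr0 => [/eqP|l /andP[/eqP il nlj]].
    by rewrite mulf_eq0 expf_eq0 (negPf y0) andbF orbF.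
  by case/eqP: nlj; apply: val_inj => /=; lia.
have := card_roots_lt p0; have : (size p <= d.+1)%N by exact: size_poly.
have := cardsC [set x | root p x].
have -> : ~: [set x | root p x] = [set x | top_form d.+1 e Q x y != 0].
  by apply/setP => x; rewrite !inE /root pE.
size_lia.
Qed.

(* In a direction where the top form does not vanish, [Q] and the decoded
   polynomial have different degrees on every line of that direction. *)
Lemma rejections_top_form (F : finFieldType) (d e : nat) (f : 'rV[F]_2 -> F)
    (P : {set 'rV[F]_2} -> 'rV[F]_2 -> F) (u v w : 'rV[F]_2)
    (Q : {poly {poly F}}) :
  best_line_decoder d f P -> (size Q <= d.+1)%N -> (sizeY Q <= d.+1)%N ->
  (d < e)%N -> (forall i j : 'I_d.+1, (e < i + j)%N -> Q`_i`_j = 0) ->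
  w != 0 -> top_form d.+1 e Q (coord1 u v w) (coord2 u v w) != 0 ->
  (#|F| ^ 2 <= rejections f P w +
     #|[set x | f x != Q.[coord1 u v x, coord2 u v x]%R]| + 2 * d * #|F|)%N.
Proof.
move=> best sQ sYQ de Q0 w0 top0.
pose g x := Q.[coord1 u v x, coord2 u v x].
pose b a := (P (line_of a w) a == f a) && (f a == g a).
have le : (#|[set a | b a]| <= 2 * d * #|F|)%N.
  have := card_line_sum w b; have q1 := card_finRing_gt1 F.
  (* On each line, [Q] and the decoded polynomial are distinct of degree at most [2 * d], since
     their coefficients of degree [e] differ. Each point is counted [#|F|] times in the sum over
     [a]. *)
  have : (\sum_a #|[set t | b (a + t *: w)%R]| <= #|F| ^ 2 * (2 * d))%N.
    rewrite -card_plane -sum_nat_const; apply: leq_sum => a _.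
    have [p sp Pp] := decoder_line_poly a best w0.
    pose r := line_restriction d.+1 Q (coord1 u v a) (coord2 u v a)
      (coord1 u v w) (coord2 u v w).
    have sr : (size r <= (2 * d).+1)%N.
      apply: size_line_restriction => i j; have := ltn_ord i; have := ltn_ord j.
      lia.
    have npr : p != r.
      apply: contraNneq top0 => pr; rewrite 
        -(coef_line_restriction (coord1 u v a) (coord2 u v a) _ _ Q0).
      by rewrite -/r -pr nth_default //; apply: leq_trans de.
    apply: leq_trans (card_poly_agree npr _ sr); last by size_lia.
    apply: subset_leq_card; apply/subsetP => t; rewrite !inE /b line_of_shift Pp.
    case/andP => /eqP -> /eqP ->.
    by rewrite /g /r horner_line_restriction // !coord1_line !coord2_line.
  move=> leS eqS; rewrite eqS in leS.
  by move: leS q1; move: #|[set a | b a]| #|F| => k q; clear; nia.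
have <- : #|'rV[F]_2| = (#|F| ^ 2)%N by exact: card_plane.
rewrite -cardsT -(cardsID [set a | b a]) setTI setTD addnC leq_add //.
have -> : ~: [set a | b a] =
    [set a | P (line_of a w) a != f a] :|: [set x | f x != g x].
  by apply/setP => a; rewrite !inE negb_and.
exact: leq_of_leqif (leq_card_setU _ _).
Qed.

Lemma close_bidegree_total (F : finFieldType) (d : nat) (f : 'rV[F]_2 -> F)
    (P : {set 'rV[F]_2} -> 'rV[F]_2 -> F) (u v : 'rV[F]_2)
    (Q : {poly {poly F}}) :
  best_line_decoder d f P -> (0 < d)%N -> (1000 * d < #|F|)%N ->
  (100 * \sum_(w | w != 0%R) rejections f P w < #|F| ^ 2 * (#|F| ^ 2).-1)%N ->
  det2 u v != 0 -> (size Q <= d.+1)%N -> (sizeY Q <= d.+1)%N ->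
  (100 * #|[set x | f x != Q.[coord1 u v x, coord2 u v x]%R]|
     <= 17 * #|F| ^ 2)%N ->
  forall i j : 'I_d.+1, (d < i + j)%N -> Q`_i`_j = 0.
Proof.
move=> best d0 qd ltN D0 sQ sYQ B17 i1 j1 dij1; apply/eqP/negPn/negP => Qij1.
pose ex n := [exists i : 'I_d.+1, exists j : 'I_d.+1,
  (i + j == n)%N && (Q`_i`_j != 0)].
have ex1 : exists n, ex n.
  exists (i1 + j1)%N; apply/existsP; exists i1; apply/existsP; exists j1.
  by rewrite eqxx.
have exb n : ex n -> (n <= 2 * d)%N.
  case/existsP => i /existsP[j /andP[/eqP <- _]].
  by have := ltn_ord i; have := ltn_ord j; lia.
(* [e] is the total degree of [Q], assumed to exceed [d]. *)
case: (ex_maxnP ex1 exb) => e /existsP[i0 /existsP[j0 /andP[/eqP ije Qij]]] maxe.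
have Q0 (i j : 'I_d.+1) : (e < i + j)%N -> Q`_i`_j = 0.
  move=> lte; apply/eqP/negPn/negP => nz.
  suff /maxe : ex (i + j)%N by lia.
  by apply/existsP; exists i; apply/existsP; exists j; rewrite eqxx.
have de : (d < e)%N.
  apply: leq_trans dij1 _; apply: maxe.
  by apply/existsP; exists i1; apply/existsP; exists j1; rewrite eqxx.
set B := #|[set x | _]| in B17.
pose S w := (coord2 u v w != 0) &&
  (top_form d.+1 e Q (coord1 u v w) (coord2 u v w) != 0).
have S0 w : S w -> w != 0.
  case/andP => c2 _; apply: contraNneq c2 => ->.
  by rewrite /coord2 /det2 !mxE !mulr0 subrr mul0r.
have leS : (#|F|.-1 * (#|F| - d) <= #|[set w | S w]|)%N.
  rewrite card_sumb (sum_coord _ D0) (bigD1 0) //=.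
  apply: leq_trans (leq_addl _ _).
  have -> : #|F|.-1 = #|predC1 (0 : F)| by rewrite cardC1.
  rewrite -sum_nat_const; apply: leq_sum => y; rewrite inE => y0.
  apply: leq_trans (card_top_form_neq0 ije Qij y0) _; rewrite card_sumb.
  by apply: leq_sum => x _; rewrite /S coord1_point // coord2_point // y0.
have leN : (#|[set w | S w]| * (#|F| ^ 2 - (B + 2 * d * #|F|)) <=
    \sum_(w | w != 0%R) rejections f P w)%N.
  rewrite -sum_nat_const [X in (_ <= X)%N](bigID S) /=.
  apply: leq_trans (leq_addr _ _).
  rewrite [X in (X <= _)%N](eq_bigl (fun w => (w != 0) && S w)) => [|w].
    apply: leq_sum => w /andP[w0 /andP[_ top0]]; rewrite leq_subLR.
    have := rejections_top_form best sQ sYQ de Q0 w0 top0.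
    by rewrite -/B -addnA addnC.
  by rewrite inE; case: (boolP (S w)) => [/S0 ->|]; rewrite ?andbF.
move: leS leN ltN B17 qd d0; move: (\sum_(w | _) _)%N #|[set w | S w]| #|F| B.
clear => N k q B leS leN ltN B17 qd d0.
(* From here [q.+1] is the order of the field. At least half of [q * q.+1] directions reject at 82
   percent of the points or more (100 - 17 - 1), against an overall rate below 1 percent. *)
case: q => [//|q] /= in leS leN ltN B17 qd *.
have hd : (200 * (d * q.+1) <= q.+1 ^ 2)%N.
  by rewrite mulnA -mulnn leq_mul2r; apply/orP; right; lia.
have h1 : (82 * q.+1 ^ 2 <= 100 * (q.+1 ^ 2 - (B + 2 * d * q.+1)))%N.
  rewrite -mulnA; move: hd B17; move: (q.+1 ^ 2)%N (d * q.+1)%N => k2 dq.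
  clear; lia.
have h2 : (q * q.+1 <= 2 * k)%N.
  apply: leq_trans (_ : q * (2 * (q.+1 - d)) <= _)%N.
    by rewrite leq_mul2l; apply/orP; right; lia.
  by rewrite mulnCA leq_mul2l.
have h3 : (q * q.+1 * (82 * q.+1 ^ 2) <= 2 * (100 * N))%N.
  apply: leq_trans (leq_mul h2 h1) _.
  by rewrite -mulnA leq_mul2l /= mulnCA leq_mul2l.
have h4 : ((q.+1 ^ 2).-1 = q * q.+2)%N by rewrite -mulnn mulSn addSn [RHS]mulnS.
have h5 : (q * q.+1 * (82 * q.+1 ^ 2) < 2 * (q.+1 ^ 2 * (q * q.+2)))%N.
  by apply: leq_ltn_trans h3 _; rewrite -h4 ltn_pmul2l.
have : (q * q.+1 ^ 2 * (82 * q.+1) < q * q.+1 ^ 2 * (2 * q.+2))%N.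
  move: h5; have -> : (q * q.+1 * (82 * q.+1 ^ 2) = q * q.+1 ^ 2 * (82 * q.+1))%N.
    by lia.
  by have -> : (2 * (q.+1 ^ 2 * (q * q.+2)) = q * q.+1 ^ 2 * (2 * q.+2))%N by lia.
by rewrite ltn_mul2l => /andP[_]; lia.
Qed.

(** * Passage to multivariate polynomials and conclusion *)

Lemma msizeD_leq (F : fieldType) (k n : nat) (p r : {mpoly F[k]}) :
  (msize p <= n)%N -> (msize r <= n)%N -> (msize (p + r)%R <= n)%N.
Proof.
by move=> sp sr; apply: leq_trans (mmeasureD_le _ _ _) _; rewrite geq_max sp sr.
Qed.

Lemma msizeM_leq (F : fieldType) (k m n : nat) (p r : {mpoly F[k]}) :
  (msize p <= m.+1)%N -> (msize r <= n.+1)%N ->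
  (msize (p * r)%R <= (m + n).+1)%N.
Proof.
have [->|p0] := eqVneq p 0; first by rewrite mul0r msize0.
have [->|r0] := eqVneq r 0; first by rewrite mulr0 msize0.
by rewrite msizeM //; move: (msize p) (msize r) => x y; lia.
Qed.

Lemma msizeX_leq (F : fieldType) (k n : nat) (p : {mpoly F[k]}) :
  (msize p <= 2)%N -> (msize (p ^+ n)%R <= n.+1)%N.
Proof.
move=> sp; elim: n => [|n IH]; first by rewrite expr0 msize1.
by rewrite exprS; apply: (@msizeM_leq _ _ 1 n).
Qed.

Definition linear_form2 (F : fieldType) (s t : F) : {mpoly F[2]} :=
  s *: 'X_0 + t *: 'X_1.

Lemma msize_linear_form2 (F : fieldType) (s t : F) :
  (msize (linear_form2 s t) <= 2)%N.
Proof.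
by apply: msizeD_leq; apply: leq_trans (msizeZ_le _ _) _;
  rewrite msizeX mdeg1.
Qed.

Lemma eval2_linear_form2 (F : finFieldType) (s t : F) (x : 'rV[F]_2) :
  eval2 (linear_form2 s t) x = s * x 0 0 + t * x 0 1.
Proof. by rewrite /eval2 mevalD !mevalZ !mevalXU. Qed.

Lemma bidegree_to_mpoly (F : finFieldType) (d : nat) (u v : 'rV[F]_2)
    (Q : {poly {poly F}}) :
  (size Q <= d.+1)%N -> (sizeY Q <= d.+1)%N ->
  (forall i j : 'I_d.+1, (d < i + j)%N -> Q`_i`_j = 0) ->
  exists2 M : {mpoly F[2]}, (msize M <= d.+1)%N &
    forall x, eval2 M x = Q.[coord1 u v x, coord2 u v x].
Proof.
(* [l1] and [l2] are the coordinate functions written as linear forms, so substituting them does not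
   raise the total degree. *)
move=> sQ sYQ Q0; pose D := (det2 u v)^-1.
pose l1 := linear_form2 (v 0 1 * D) (- v 0 0 * D).
pose l2 := linear_form2 (- u 0 1 * D) (u 0 0 * D).
exists (\sum_(i < d.+1) \sum_(j < d.+1) Q`_i`_j *: (l1 ^+ i * l2 ^+ j)) => [|x].
  elim/big_ind: _ => [|p r|i _]; [by rewrite msize0 | exact: msizeD_leq |].
  elim/big_ind: _ => [|p r|j _]; [by rewrite msize0 | exact: msizeD_leq |].
  have [le|lt] := leqP (i + j) d; last by rewrite Q0 // scale0r msize0.
  apply: leq_trans (msizeZ_le _ _) _; apply: leq_trans (_ : (i + j).+1 <= _)%N => //.
  by apply: msizeM_leq; apply: msizeX_leq; apply: msize_linear_form2.
rewrite (horner2_coef_wide _ _ sQ sYQ) /eval2 rmorph_sum.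
apply: eq_bigr => i _; rewrite rmorph_sum; apply: eq_bigr => j _ /=.
rewrite mevalZ mevalM !rmorphXn /= -!/(eval2 _ _) !eval2_linear_form2.
by congr (_ * (_ ^+ _ * _ ^+ _)); rewrite /coord1 /coord2 {1}/det2 -/D; ring.
Qed.

Lemma rejections_close_polynomial (F : finFieldType) (d : nat)
    (f : 'rV[F]_2 -> F) (P : {set 'rV[F]_2} -> 'rV[F]_2 -> F) :
  best_line_decoder d f P -> (1000 * d < #|F|)%N ->
  (100 * \sum_(w | w != 0%R) rejections f P w < #|F| ^ 2 * (#|F| ^ 2).-1)%N ->
  exists2 M : {mpoly F[2]}, (msize M <= d.+1)%N &
    (#|[set x | f x != eval2 M x]| * (#|F| ^ 2).-1 <=
       2 * \sum_(w | w != 0%R) rejections f P w)%N.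
Proof.
(* For [d = 0] the hypothesis gives no useful lower bound on the order of the field, so the grid
   argument is replaced by the one for constants. *)
case: d => [|d'] best qd ltN; last move: d'.+1 (ltn0Sn d') best qd => {d'} d d0 best qd.
  have [c lec] := constant_test best; exists c%:MP; first by rewrite msizeC; case: eqP.
  apply: leq_trans lec; rewrite leq_mul2r; apply/orP; right.
  by apply: eq_leq; apply: eq_card => x; rewrite !inE /eval2 mevalC.
have [u [v [Q [D0 sQ sYQ B17]]]] := close_to_bidegree best d0 qd ltN.
have Q0 := close_bidegree_total best d0 qd ltN D0 sQ sYQ B17.
have [M sM evM] := bidegree_to_mpoly u v sQ sYQ Q0; exists M => //.
apply: (close_imp_closer best) => [b w||]; last by lia.
  exists (line_restriction d.+1 Q (coord1 u v b) (coord2 u v b)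
    (coord1 u v w) (coord2 u v w)) => [|t]; first exact: size_line_restriction.
  by rewrite evM horner_line_restriction // coord1_line coord2_line.
have -> : [set x | f x != eval2 M x] =
    [set x | f x != Q.[coord1 u v x, coord2 u v x]].
  by apply/setP => x; rewrite !inE evM.
by move: B17; size_lia.
Qed.

Theorem theorem4p5 :
  exists C : nat,
  forall (R : realFieldType) (F : finFieldType) (d : nat),
    (C * d < #|F|)%N ->
  forall (delta : R), delta < 1 / 100 ->
  forall (f : 'rV[F]_2 -> F) (P : {set 'rV[F]_2} -> 'rV[F]_2 -> F),
    best_line_decoder d f P ->
    1 - delta <= ldt_accept_prob R f P ->
  exists Q : {mpoly F[2]},
    (msize Q <= d.+1)%N /\ 1 - 2 * delta <= agree_prob2 R f Q.
Proof.
exists 1000 => R F d qd delta ltd f P best /ldt_rejections leN.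
have q1 : (1 < #|F|)%N := card_finRing_gt1 F.
have kk : (0 < #|F| ^ 2 * (#|F| ^ 2).-1)%N by nia.
have kkR : 0 < (#|F| ^ 2 * (#|F| ^ 2).-1)%N%:R :> R by rewrite ltr0n.
(* The real bound [delta < 1 / 100] becomes a strict inequality between integers. *)
have ltN : (100 * \sum_(w | w != 0%R) rejections f P w <
    #|F| ^ 2 * (#|F| ^ 2).-1)%N.
  rewrite -(ltr_nat R) natrM mulrC -ltr_pdivlMr ?ltr0n //.
  by apply: le_lt_trans leN _; rewrite mulrC ltr_pM2l // -div1r.
have [Q sQ leB] := rejections_close_polynomial best qd ltN; exists Q; split=> //.
rewrite /agree_prob2 card_plane.
have := cardsC [set x | f x == eval2 Q x]; rewrite card_plane.
have -> : ~: [set x | f x == eval2 Q x] = [set x | f x != eval2 Q x].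
  by apply/setP => x; rewrite !inE.
move: leB leN kk kkR; move: (\sum_(w | _) _)%N #|[set x | f x != _]| => N B.
move: #|[set x | _]| (#|F| ^ 2)%N => A k leB leN kk kkR kE.
have k0 : 0 < k%:R :> R by rewrite ltr0n; nia.
have k1 : 0 < k.-1%:R :> R by rewrite ltr0n; nia.
(* It remains to bound the errors by [B <= 2 * delta * k]; this is obtained after multiplying by
   [k.-1], from [B * k.-1 <= 2 * N] and [N <= delta * (k * k.-1)]. *)
rewrite ler_pdivlMr // mulrBl mul1r lerBlDr -{1}kE natrD lerD2l.
rewrite -(ler_pM2r k1) -mulrA -natrM.
move: leB; rewrite -(ler_nat R) !natrM => /le_trans; apply.
by rewrite -mulrA ler_pM2l ?ltr0n // -natrM.
Qed.
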